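(* Let $d\ge2$ and let $(X_n)$ be a positive recurrent rotor walk on $\mathbb{T}_d$ (i.e. $\mathbb{E}[\rho(v)]>d-1$) with i.i.d. random initial configuration. Let $\tau_0=0$ and $\tau_k=\inf\{n>\tau_{k-1}: X_n=o\}$ for $k\ge1$ (these are almost surely finite). Then $$\lim_{k\to\infty}\frac{|R_{\tau_k}|}{\tau_k}=\frac{d-1}{2\,\mathbb{E}[\rho(v)]}\quad\text{almost surely}.$$
   Context: Fix an integer $d\ge2$. Let $\widetilde{\mathbb{T}}_d$ be the rooted tree with root $r$ in which every vertex has exactly $d$ children, and let $\mathbb{T}_d$ be $\widetilde{\mathbb{T}}_d$ together with an extra vertex $o$ (the sink) joined by an edge to $r$. For $v\in\widetilde{\mathbb{T}}_d$ its $d+1$ neighbours are labelled $v^{(0)},v^{(1)},\dots,v^{(d)}$, where $v^{(0)}$ is the parent of $v$ (with $r^{(0)}=o$) and $v^{(1)},\dots,v^{(d)}$ are the children of $v$ in a fixed order. A rotor configuration is a map $\rho:\widetilde{\mathbb{T}}_d\to\{0,1,\dots,d\}$. The rotor walk $(X_n)_{n\ge0}$ with initial configuration $\rho_0=\rho$ starts at $X_0=r$; if $X_n=v\in\widetilde{\mathbb{T}}_d$ then $\rho_{n+1}(v)=\rho_n(v)+1 \pmod{d+1}$, $\rho_{n+1}(u)=\rho_n(u)$ for $u\neq v$, and $X_{n+1}=v^{(\rho_{n+1}(v))}$; if $X_n=o$ then $X_{n+1}=r$ and the rotors are unchanged. The initial configuration is random: the $\rho(v)$, $v\in\widetilde{\mathbb{T}}_d$,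 are i.i.d. with $\mathbb{P}[\rho(v)=j]=r_j$ for $j=0,\dots,d$, $\sum_j r_j=1$. The range is $R_n=\{X_0,\dots,X_n\}\setminus\{o\}$ and $|R_n|$ is its cardinality. *)

(* Defs.v *)
From Stdlib Require Import Reals List Arith.
Import ListNotations.
Open Scope R_scope.

(* A vertex of the d-ary tree T~_d is encoded as the list of child indices
   read from the vertex up to the root r (r = []).  The child v^(i),
   1 <= i <= d, of v is (i-1) :: v; the parent v^(0) of i::v is v; the parent
   of the root is the sink o.  Valid vertices have all entries < d. *)
Definition vertex := list nat.
Definition valid (d : nat) (v : vertex) : Prop := Forall (fun i => (i < d)%nat) v.

(* rotor configuration (values in {0,...,d}) *)
Definition config := vertex -> nat.

(* position: None = sink o, Some v = vertex v *)
Definition state := (option vertex * config)%type.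

Definition rotor_step (d : nat) (s : state) : state :=
  match fst s with
  | None => (Some [], snd s)
  | Some v =>
      let k := ((snd s v + 1) mod (d + 1))%nat in
      let rho' := fun u => if list_eq_dec Nat.eq_dec u v then k else snd s u in
      (if Nat.eqb k 0
       then match v with [] => None | _ :: t => Some t end
       else Some ((k - 1)%nat :: v),
       rho')
  end.

Definition rotor_state (d : nat) (rho : config) (n : nat) : state :=
  Nat.iter n (rotor_step d) (Some [], rho).

Definition X (d : nat) (rho : config) (n : nat) : option vertex :=
  fst (rotor_state d rho n).

Definition sites (x : option vertex) : list vertex :=
  match x with None => [] | Some v => [v] end.

Fixpoint visited (d : nat) (rho : config) (n : nat) : list vertex :=
  match n with
  | O => sites (X d rho 0)
  | S m => sites (X d rho (S m)) ++ visited d rho m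
  end.

Definition range_card (d : nat) (rho : config) (n : nat) : nat :=
  length (nodup (list_eq_dec Nat.eq_dec) (visited d rho n)).

Fixpoint returns (d : nat) (rho : config) (n : nat) : nat :=
  match n with
  | O => O
  | S m => ((match X d rho (S m) with None => 1 | Some _ => 0 end) + returns d rho m)%nat
  end.

Definition is_return_time (d : nat) (rho : config) (k n : nat) : Prop :=
  (k = 0%nat /\ n = 0%nat) \/
  ((1 <= k)%nat /\ X d rho n = None /\ returns d rho n = k).

Definition is_sigma_algebra {Om : Type} (F : (Om -> Prop) -> Prop) : Prop :=
  F (fun _ => True) /\
  (forall A, F A -> F (fun w => ~ A w)) /\
  (forall A : nat -> (Om -> Prop), (forall n, F (A n)) -> F (fun w => exists n, A n w)).

Definition is_probability_space {Om : Type} (F : (Om -> Prop) -> Prop)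
  (P : (Om -> Prop) -> R) : Prop :=
  is_sigma_algebra F /\
  (forall A, F A -> 0 <= P A) /\
  P (fun _ => True) = 1 /\
  (forall A : nat -> (Om -> Prop),
      (forall n, F (A n)) ->
      (forall n m w, n <> m -> A n w -> A m w -> False) ->
      infinite_sum (fun n => P (A n)) (P (fun w => exists n, A n w))).

Definition prob_vector (d : nat) (r : nat -> R) : Prop :=
  (forall j, (j <= d)%nat -> 0 <= r j) /\ sum_f_R0 r d = 1.

Definition mean (d : nat) (r : nat -> R) : R := sum_f_R0 (fun j => INR j * r j) d.

(* the rho(v), v in T~_d, are i.i.d. with P[rho(v) = j] = r_j:
   all finite-dimensional distributions on distinct vertices are products *)
Definition iid_config {Om : Type} (d : nat) (r : nat -> R)
  (P : (Om -> Prop) -> R) (rho : Om -> config) : Prop :=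
  forall l : list (vertex * nat),
    NoDup (map fst l) -> Forall (valid d) (map fst l) ->
    P (fun w => Forall (fun p => rho w (fst p) = snd p) l) =
    fold_right (fun p acc => r (snd p) * acc) 1 l.

(* Main.v *)
Require Import Defs.
From Stdlib Require Import Reals List Arith Lra Lia Classical ClassicalEpsilon
  FunctionalExtensionality PropExtensionality Permutation.
Import ListNotations.
Open Scope R_scope.

(** Let the level of a vertex be the number of the excursion in which it is first visited: the
    root has level 1, and a child of [v] with 0-based index [i] has the level of [v] if
    [i >= rho v], and one more otherwise. Since a rotor is back at 0 whenever its vertex has been
    left towards the parent, excursion [k] visits exactly the [m_k] vertices of level at most
    [k], crossing the edge above each of them twice; hence [tau_k + 1 = 2 (m_1 + ... + m_k)].

    Explore the tree from a queue, pushing the children of the current level to the front and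
    those of the next level to the back. The vertices then come in order of level, and each one
    is determined by the rotors read before it, so the rotors read form an i.i.d. sequence of
    law [r]. Its partial sums [S_n] satisfy [S_n / n -> E rho] almost surely (exponential moments
    and Borel-Cantelli). As [E rho > d - 1], every level is exhausted after finitely many
    steps, and counting pending vertices gives
    [S_{m_{k+1}} = S_{m_k} + (d - 1) m_{k+1} + 1]. Summing,
    [(d - 1) (tau_k + 1) = 2 (S_{m_k} - k)], while [m_k + 1 >= 2 ^ k]; so
    [(d - 1) tau_k / m_k -> 2 E rho]. *)

(** Since [F] and [P] act on predicates, equivalent events have to be made equal before either can
    be rewritten. *)
Lemma event_ext {Om : Type} (A B : Om -> Prop) : (forall w, A w <-> B w) -> A = B.
Proof.
  intros H; extensionality w; apply propositional_extensionality, H.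
Qed.

Lemma event_ext_in {Om : Type} (F : (Om -> Prop) -> Prop) (A B : Om -> Prop) :
  (forall w, A w <-> B w) -> F B -> F A.
Proof. intros H HB; rewrite (event_ext A B H); exact HB. Qed.

(** * Probability spaces *)

Section Probability.

Context {Om : Type} {F : (Om -> Prop) -> Prop} {P : (Om -> Prop) -> R}.
Hypothesis prob : is_probability_space F P.

Lemma event_full : F (fun _ => True).
Proof. exact (proj1 (proj1 prob)). Qed.

Lemma event_compl A : F A -> F (fun w => ~ A w).
Proof. exact (proj1 (proj2 (proj1 prob)) A). Qed.

Lemma event_union (A : nat -> Om -> Prop) :
  (forall n, F (A n)) -> F (fun w => exists n, A n w).
Proof. exact (proj2 (proj2 (proj1 prob)) A). Qed.

Lemma event_inter (A : nat -> Om -> Prop) :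
  (forall n, F (A n)) -> F (fun w => forall n, A n w).
Proof.
  intros H.
  apply event_ext_in with (fun w => ~ exists n, ~ A n w).
  - intros w; split.
    + intros Hw [n Hn]; apply Hn, Hw.
    + intros Hw n; apply NNPP; intros Hn; apply Hw; exists n; exact Hn.
  - apply event_compl, event_union; intros n; apply event_compl, H.
Qed.

Lemma event_empty : F (fun _ => False).
Proof.
  apply event_ext_in with (fun _ => ~ True); [tauto |].
  apply event_compl, event_full.
Qed.

Lemma event_or A B : F A -> F B -> F (fun w => A w \/ B w).
Proof.
  intros HA HB.
  apply event_ext_in with (fun w => exists n : nat, (if Nat.eqb n 0 then A else B) w).
  - intros w; split.
    + intros [H | H]; [exists 0%nat | exists 1%nat]; exact H.
    + intros [n H]; destruct (Nat.eqb n 0); tauto.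
  - apply event_union; intros n; destruct (Nat.eqb n 0); assumption.
Qed.

Lemma event_and A B : F A -> F B -> F (fun w => A w /\ B w).
Proof.
  intros HA HB.
  apply event_ext_in with (fun w => ~ (~ A w \/ ~ B w)); [intros w; tauto |].
  apply event_compl, event_or; apply event_compl; assumption.
Qed.

Lemma event_bounded_union (A : nat -> Om -> Prop) n :
  (forall m, F (A m)) -> F (fun w => exists m, (m < n)%nat /\ A m w).
Proof.
  intros HA; apply event_union; intros m.
  destruct (lt_dec m n) as [Hm | Hm].
  - apply event_ext_in with (A m); [tauto | apply HA].
  - apply event_ext_in with (fun _ => False); [tauto | apply event_empty].
Qed.

Lemma prob_nonneg A : F A -> 0 <= P A.
Proof. exact (proj1 (proj2 prob) A). Qed.

Lemma prob_full : P (fun _ => True) = 1.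
Proof. exact (proj1 (proj2 (proj2 prob))). Qed.

Lemma prob_sigma_additive (A : nat -> Om -> Prop) :
  (forall n, F (A n)) ->
  (forall n m w, n <> m -> A n w -> A m w -> False) ->
  infinite_sum (fun n => P (A n)) (P (fun w => exists n, A n w)).
Proof. exact (proj2 (proj2 (proj2 prob)) A). Qed.

Lemma infinite_sum_unique f l l' : infinite_sum f l -> infinite_sum f l' -> l = l'.
Proof. intros H H'; exact (UL_sequence _ _ _ H H'). Qed.

Lemma prob_empty : P (fun _ => False) = 0.
Proof.
  assert (H := prob_sigma_additive (fun _ _ => False)
                 (fun _ => event_empty) (fun _ _ _ _ H _ => H)).
  cbv beta in H.
  rewrite (event_ext (fun _ => exists _ : nat, False) (fun _ => False)) in H
    by (intros w; split; [intros [_ []] | tauto]).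
  set (p := P (fun _ => False)) in *.
  assert (Hp : 0 <= p) by apply prob_nonneg, event_empty.
  destruct (Req_dec p 0) as [E | E]; [exact E | exfalso].
  destruct (H p ltac:(lra)) as [N HN].
  (* The partial sum of index [S N] has [N + 2] terms, so it lies at distance [p * (N + 1) >= p]
     from [p]. Index [N] would not do when [N = 0]. *)
  specialize (HN (S N) ltac:(lia)); unfold Rdist in HN.
  rewrite sum_cte, !S_INR in HN.
  assert (HN0 := pos_INR N).
  rewrite Rabs_pos_eq in HN by nra.
  nra.
Qed.

Lemma infinite_sum_finite f n :
  (forall m, (n < m)%nat -> f m = 0) -> infinite_sum f (sum_f_R0 f n).
Proof.
  intros H e He; exists n; intros m Hm.
  assert (E : sum_f_R0 f m = sum_f_R0 f n).
  { induction m as [| m IH].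
    - replace n with 0%nat by lia; reflexivity.
    - destruct (Nat.eq_dec n (S m)) as [-> | Hne]; [reflexivity |].
      simpl; rewrite IH, H by lia; lra. }
  rewrite E, Rdist_eq; exact He.
Qed.

Lemma prob_finite_additive (A : nat -> Om -> Prop) n :
  (forall m, F (A m)) ->
  (forall m m' w, m <> m' -> A m w -> A m' w -> False) ->
  P (fun w => exists m, (m <= n)%nat /\ A m w) = sum_f_R0 (fun m => P (A m)) n.
Proof.
  intros HA Hdis.
  (* Emptying the events past [n] turns the countable sum into a finite one. *)
  set (B := fun m w => (m <= n)%nat /\ A m w).
  assert (HB : forall m, (m <= n)%nat -> B m = A m)
    by (intros m Hm; apply event_ext; unfold B; tauto).
  assert (HB0 : forall m, (n < m)%nat -> B m = fun _ => False)
    by (intros m Hm; apply event_ext; unfold B; intros w; split; [lia | tauto]).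
  apply infinite_sum_unique with (fun m => P (B m)).
  - apply (prob_sigma_additive B).
    + intros m; destruct (le_lt_dec m n) as [Hm | Hm];
        [rewrite HB by exact Hm; apply HA | rewrite HB0 by exact Hm; apply event_empty].
    + intros m m' w Hne [_ H] [_ H']; exact (Hdis m m' w Hne H H').
  - rewrite (sum_eq _ (fun m => P (B m))) by (intros m Hm; rewrite HB by exact Hm; reflexivity).
    apply infinite_sum_finite; intros m Hm; rewrite HB0 by exact Hm; apply prob_empty.
Qed.

Lemma prob_disjoint_or A B :
  F A -> F B -> (forall w, A w -> B w -> False) ->
  P (fun w => A w \/ B w) = P A + P B.
Proof.
  intros HA HB Hdis.
  set (C := fun n : nat => match n with 0%nat => A | 1%nat => B | _ => fun _ => False end).
  assert (E := prob_finite_additive C 1); simpl in E.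
  rewrite <- E.
  - f_equal; apply event_ext; intros w; split.
    + intros [H | H]; [exists 0%nat | exists 1%nat]; (split; [lia | exact H]).
    + intros [[| [| m]] [Hm H]]; simpl in H; tauto.
  - intros [| [| m]]; simpl; [exact HA | exact HB | apply event_empty].
  - intros [| [| m]] [| [| m']] w Hne H H'; simpl in *; try tauto; try lia;
      apply (Hdis w); assumption.
Qed.

Lemma prob_compl A : F A -> P (fun w => ~ A w) = 1 - P A.
Proof.
  intros HA.
  assert (E := prob_disjoint_or A (fun w => ~ A w) HA (event_compl A HA)
                 (fun w H H' => H' H)).
  cbv beta in E.
  rewrite (event_ext (fun w => A w \/ ~ A w) (fun _ => True)), prob_full in E
    by (intros w; split; [tauto | intros _; apply classic]).
  lra.
Qed.

Lemma prob_mono A B : F A -> F B -> (forall w, A w -> B w) -> P A <= P B.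
Proof.
  intros HA HB Hsub.
  assert (HD : F (fun w => B w /\ ~ A w)) by (apply event_and; [| apply event_compl]; assumption).
  assert (E := prob_disjoint_or A _ HA HD (fun w H H' => proj2 H' H)).
  cbv beta in E.
  rewrite (event_ext (fun w => A w \/ B w /\ ~ A w) B) in E.
  - assert (H := prob_nonneg _ HD); lra.
  - intros w; split; [intros [H | H]; [apply Hsub, H | tauto] |].
    intros H; destruct (classic (A w)); tauto.
Qed.

(** Countable subadditivity. Bounding all partial sums by [l] avoids speaking of the sum of the
    series. *)
Lemma prob_union_le (A : nat -> Om -> Prop) l :
  (forall n, F (A n)) ->
  (forall n, sum_f_R0 (fun m => P (A m)) n <= l) ->
  P (fun w => exists n, A n w) <= l.
Proof.
  intros HA Hl.
  (* [D n] says that [n] is the first index whose event occurs; these events are disjoint and have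
     the same union. *)
  set (D := fun n w => A n w /\ ~ exists m, (m < n)%nat /\ A m w).
  assert (HD : forall n, F (D n)).
  { intros n; apply event_and; [apply HA |].
    apply event_compl, event_bounded_union, HA. }
  assert (E : (fun w => exists n, A n w) = (fun w => exists n, D n w)).
  { apply event_ext; intros w; split.
    - intros [n Hn]; revert Hn; induction n as [n IH] using lt_wf_ind; intros Hn.
      destruct (classic (exists m, (m < n)%nat /\ A m w)) as [[m [Hm Hmw]] | Hno].
      + exact (IH m Hm Hmw).
      + exists n; split; assumption.
    - intros [n [Hn _]]; exists n; exact Hn. }
  rewrite E.
  assert (Hsum := prob_sigma_additive D HD).
  apply Rle_cv_lim with (Un := sum_f_R0 (fun n => P (D n))) (Vn := fun _ : nat => l).
  - intros n; apply Rle_trans with (2 := Hl n).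
    apply sum_Rle; intros m _; apply prob_mono; [apply HD | apply HA | intros w [H _]; exact H].
  - apply Hsum; intros n m w Hne [Hn Hn'] [Hm Hm'].
    destruct (Nat.lt_total n m) as [H | [H | H]]; [| contradiction |];
      [apply Hm'; exists n | apply Hn'; exists m]; split; assumption.
  - intros e He; exists 0%nat; intros n _; rewrite Rdist_eq; exact He.
Qed.

(** The complement is a countable union of null events. *)
Lemma almost_sure_inter (A : nat -> Om -> Prop) :
  (forall n, F (A n)) -> (forall n, P (A n) = 1) ->
  P (fun w => forall n, A n w) = 1.
Proof.
  intros HA H1.
  assert (HI := event_inter A HA).
  assert (Hc := prob_compl _ HI).
  cbv beta in Hc.
  rewrite (event_ext (fun w => ~ forall n, A n w) (fun w => exists n, ~ A n w)) in Hc.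
  - assert (Hle : P (fun w => exists n, ~ A n w) <= 0).
    { apply (prob_union_le (fun n w => ~ A n w)).
      - intros n; apply event_compl, HA.
      - intros n; rewrite (sum_eq _ (fun _ => 0)).
        + rewrite sum_cte; lra.
        + intros m _; rewrite prob_compl by apply HA; rewrite H1; lra. }
    assert (H0 := prob_nonneg _ (event_union _ (fun n => event_compl _ (HA n)))).
    cbv beta in H0; lra.
  - intros w; split.
    + intros H; apply not_all_ex_not, H.
    + intros [n Hn] H; apply Hn, H.
Qed.

(** If infinitely many [B n] occur, then every tail union [T N] occurs; its probability is at most
    the geometric tail [q ^ N / (1 - q)], which tends to 0. *)
Lemma borel_cantelli_geometric (B : nat -> Om -> Prop) q :
  0 <= q < 1 -> (forall n, F (B n)) -> (forall n, P (B n) <= q ^ n) ->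
  F (fun w => exists N, forall n, (N <= n)%nat -> ~ B n w) /\
  P (fun w => exists N, forall n, (N <= n)%nat -> ~ B n w) = 1.
Proof.
  intros Hq HB HP.
  set (T := fun N w => exists n, B (N + n)%nat w).
  assert (HT : forall N, F (T N)) by (intros N; apply event_union; intros n; apply HB).
  assert (E : (fun w => exists N, forall n, (N <= n)%nat -> ~ B n w)
              = (fun w => ~ forall N, T N w)).
  { apply event_ext; intros w; split.
    - intros [N HN] H; destruct (H N) as [n Hn]; exact (HN (N + n)%nat ltac:(lia) Hn).
    - intros H; apply not_all_ex_not in H; destruct H as [N HN].
      exists N; intros n Hn Hw; apply HN; exists (n - N)%nat.
      replace (N + (n - N))%nat with n by lia; exact Hw. }
  rewrite E; split; [apply event_compl, event_inter, HT |].
  rewrite prob_compl by apply event_inter, HT.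
  enough (P (fun w => forall N, T N w) = 0) by lra.
  apply Rle_antisym; [| apply prob_nonneg, event_inter, HT].
  assert (HN : forall N, P (fun w => forall N, T N w) <= q ^ N * / (1 - q)).
  { intros N; apply Rle_trans with (P (T N)).
    - apply prob_mono; [apply event_inter, HT | apply HT | intros w H; apply H].
    - apply (prob_union_le (fun n => B (N + n)%nat)); [intros n; apply HB |].
      intros n; apply Rle_trans with (sum_f_R0 (fun m => q ^ m * q ^ N) n).
      + apply sum_Rle; intros m _; rewrite <- pow_add, Nat.add_comm; apply HP.
      + rewrite <- (scal_sum (fun m => q ^ m)), tech3 by lra.
        assert (0 < / (1 - q)) by (apply Rinv_0_lt_compat; lra).
        assert (0 <= q ^ S n) by (apply pow_le; lra).
        assert (0 <= q ^ N) by (apply pow_le; lra).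
        apply Rmult_le_compat_l; [lra |].
        rewrite <- (Rmult_1_l (/ (1 - q))); apply Rmult_le_compat_r; lra. }
  apply Rle_cv_lim with (Un := fun _ : nat => P (fun w => forall N, T N w))
                        (Vn := fun N => q ^ N * / (1 - q)).
  - exact HN.
  - intros e He; exists 0%nat; intros n _; rewrite Rdist_eq; exact He.
  - rewrite <- (Rmult_0_l (/ (1 - q))).
    apply (CV_mult (fun N => q ^ N) (fun _ => / (1 - q))).
    + intros e He; destruct (pow_lt_1_zero q ltac:(rewrite Rabs_pos_eq; lra) e He) as [N H].
      exists N; intros n Hn; unfold Rdist; rewrite Rminus_0_r; exact (H n Hn).
    + intros e He; exists 0%nat; intros n _; rewrite Rdist_eq; exact He.
Qed.

End Probability.

(** * Levels and the exploration queue *)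

Definition descends (v u : vertex) : Prop := exists s, u = s ++ v.

Lemma descends_refl v : descends v v.
Proof. exists []; reflexivity. Qed.

Lemma descends_trans u v w : descends u v -> descends v w -> descends u w.
Proof. intros [s ->] [t ->]; exists (t ++ s); apply app_assoc. Qed.

Lemma descends_child v i : descends v (i :: v).
Proof. exists [i]; reflexivity. Qed.

Lemma descends_root v : descends [] v.
Proof. exists v; symmetry; apply app_nil_r. Qed.

Lemma descends_length v u : descends v u -> (length v <= length u)%nat.
Proof. intros [s ->]; rewrite length_app; lia. Qed.

Lemma descends_length_eq v u : descends v u -> length u = length v -> u = v.
Proof.
  intros [[| i s] ->]; [reflexivity |].
  rewrite length_app; simpl; lia.
Qed.

Lemma descends_cons_inv v i u : descends v (i :: u) -> v = i :: u \/ descends v u.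
Proof.
  intros [[| j s] E]; [left; symmetry; exact E | right].
  injection E as _ E; exists s; exact E.
Qed.

Lemma descends_through_child v u :
  descends v u -> u = v \/ exists i, descends (i :: v) u.
Proof.
  intros [s ->]; induction s as [| i s _] using rev_ind; [left; reflexivity | right].
  exists i, s; rewrite <- app_assoc; reflexivity.
Qed.

Lemma descends_child_unique v i j u :
  descends (i :: v) u -> descends (j :: v) u -> i = j.
Proof.
  intros [s ->] [t E].
  change (i :: v) with ([i] ++ v) in E; change (j :: v) with ([j] ++ v) in E.
  rewrite !app_assoc in E; apply app_inv_tail, app_inj_tail in E; exact (proj2 E).
Qed.

Lemma descends_valid d v u : descends v u -> valid d u -> valid d v.
Proof. intros [s ->] H; apply Forall_app in H; exact (proj2 H). Qed.

Fixpoint level (c : config) (v : vertex) : nat :=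
  match v with
  | [] => 1
  | i :: u => level c u + if (i <? c u)%nat then 1 else 0
  end.

Lemma level_pos c v : (1 <= level c v)%nat.
Proof. induction v as [| i v IH]; simpl; lia. Qed.

Lemma level_mono c v u : descends v u -> (level c v <= level c u)%nat.
Proof. intros [s ->]; induction s as [| i s IH]; simpl; lia. Qed.

(** The label [x] of the head is an argument of its own, so that the queue can be run on a
    prescribed word of labels as well as on a configuration. *)
Definition expand (d x : nat) (q : list vertex) : list vertex :=
  match q with
  | [] => []
  | v :: t => map (fun i => i :: v) (seq x (d - x)) ++ t ++ map (fun i => i :: v) (seq 0 x)
  end.

Definition expand_by (d : nat) (c : config) (q : list vertex) : list vertex :=
  expand d (c (hd [] q)) q.

Definition queue (d : nat) (c : config) (n : nat) (q : list vertex) : list vertex :=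
  Nat.iter n (expand_by d c) q.

Definition explored (d : nat) (c : config) (n : nat) : vertex :=
  hd [] (queue d c n [[]]).

Definition label (d : nat) (c : config) (n : nat) : nat := c (explored d c n).

Definition label_sum (d : nat) (c : config) (n : nat) : nat :=
  list_sum (map (label d c) (seq 0 n)).

(* The pairs (vertex, label) read when the labels are known in advance to be [a]. *)
Fixpoint cylinder (d : nat) (q : list vertex) (a : list nat) : list (vertex * nat) :=
  match a with
  | [] => []
  | x :: b => (hd [] q, x) :: cylinder d (expand d x q) b
  end.

(** * Distinctness and validity of the vertices read *)

Definition antichain (q : list vertex) : Prop :=
  NoDup q /\ forall u v, In u q -> In v q -> descends u v -> u = v.

Lemma expand_permutation d x v q :
  (x <= d)%nat ->
  Permutation (expand d x (v :: q)) (map (fun i => i :: v) (seq 0 d) ++ q).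
Proof.
  intros Hx; simpl.
  replace d with (x + (d - x))%nat at 2 by lia.
  rewrite seq_app, map_app, <- app_assoc; simpl.
  rewrite app_assoc; apply Permutation_trans with (1 := Permutation_app_comm _ _).
  reflexivity.
Qed.

Lemma in_expand d x v q u :
  (x <= d)%nat ->
  In u (expand d x (v :: q)) <-> In u q \/ exists i, (i < d)%nat /\ u = i :: v.
Proof.
  intros Hx; split.
  - intros H; apply (Permutation_in _ (expand_permutation d x v q Hx)), in_app_iff in H.
    destruct H as [H | H]; [right | left; exact H].
    apply in_map_iff in H; destruct H as [i [<- Hi]]; apply in_seq in Hi.
    exists i; split; [lia | reflexivity].
  - intros H; apply (Permutation_in _ (Permutation_sym (expand_permutation d x v q Hx))).
    apply in_app_iff; destruct H as [H | [i [Hi ->]]]; [right; exact H | left].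
    apply in_map_iff; exists i; split; [reflexivity | apply in_seq; lia].
Qed.

Lemma length_expand d x v q :
  (x <= d)%nat -> length (expand d x (v :: q)) = (d + length q)%nat.
Proof.
  intros Hx; rewrite (Permutation_length (expand_permutation d x v q Hx)).
  rewrite length_app, length_map, length_seq; reflexivity.
Qed.

Lemma antichain_expand d x q :
  (x <= d)%nat -> antichain q -> antichain (expand d x q).
Proof.
  intros Hx; destruct q as [| v q]; [trivial |]; intros [Hnd Hac].
  inversion Hnd as [| v' q' Hv Hq]; subst.
  (* The head is incomparable with the rest of the queue, in both directions; its children inherit
     this. *)
  assert (Hvq : forall b, In b q -> ~ descends v b).
  { intros b Hb H; apply Hv; rewrite (Hac v b (in_eq _ _) (in_cons _ _ _ Hb) H); exact Hb. }
  assert (Hqv : forall b, In b q -> ~ descends b v).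
  { intros b Hb H; apply Hv; rewrite <- (Hac b v (in_cons _ _ _ Hb) (in_eq _ _) H); exact Hb. }
  split.
  - apply (Permutation_NoDup (Permutation_sym (expand_permutation d x v q Hx))).
    apply NoDup_app; [| exact Hq |].
    + apply NoDup_map_NoDup_ForallPairs; [| apply seq_NoDup].
      intros i j _ _ E; injection E as E; exact E.
    + intros u Hu Hu'; apply in_map_iff in Hu; destruct Hu as [i [<- _]].
      exact (Hvq _ Hu' (descends_child v i)).
  - intros a b Ha Hb Hab; apply in_expand in Ha, Hb; try exact Hx.
    destruct Ha as [Ha | [i [_ ->]]], Hb as [Hb | [j [_ ->]]].
    + apply Hac; [right | right |]; assumption.
    + exfalso; apply descends_cons_inv in Hab; destruct Hab as [-> | Hab].
      * exact (Hvq _ Ha (descends_child v j)).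
      * exact (Hqv _ Ha Hab).
    + exfalso; exact (Hvq b Hb (descends_trans _ _ _ (descends_child v i) Hab)).
    + symmetry; apply descends_length_eq; [exact Hab | reflexivity].
Qed.

Lemma valid_expand d x q :
  (x <= d)%nat -> Forall (valid d) q -> Forall (valid d) (expand d x q).
Proof.
  intros Hx; destruct q as [| v q]; [trivial |]; intros H.
  inversion H as [| v' q' Hv Hq]; subst.
  apply Forall_forall; intros u Hu; apply in_expand in Hu; [| exact Hx].
  destruct Hu as [Hu | [i [Hi ->]]].
  - exact (proj1 (Forall_forall _ _) Hq u Hu).
  - constructor; assumption.
Qed.

Lemma expand_nonempty d x q :
  (2 <= d)%nat -> (x <= d)%nat -> q <> [] -> expand d x q <> [].
Proof.
  intros Hd Hx Hq; destruct q as [| v q]; [contradiction |]; intros E.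
  assert (L := length_expand d x v q Hx); rewrite E in L; simpl in L; lia.
Qed.

Lemma cylinder_descends d q a u :
  (2 <= d)%nat -> Forall (fun x => (x <= d)%nat) a -> q <> [] ->
  In u (map fst (cylinder d q a)) -> exists v, In v q /\ descends v u.
Proof.
  intros Hd; revert q; induction a as [| x a IH]; intros q Ha Hq Hu; [contradiction |].
  inversion Ha as [| x' a' Hx Ha']; subst.
  destruct q as [| v q]; [contradiction |].
  destruct Hu as [<- | Hu]; [exists v; split; [left; reflexivity | apply descends_refl] |].
  destruct (IH (expand d x (v :: q)) Ha' (expand_nonempty d x _ Hd Hx Hq) Hu) as [w [Hw Hwu]].
  apply in_expand in Hw; [| exact Hx].
  destruct Hw as [Hw | [i [_ ->]]].
  - exists w; split; [right |]; assumption.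
  - exists v; split; [left; reflexivity |].
    exact (descends_trans _ _ _ (descends_child v i) Hwu).
Qed.

(** A vertex read again would lie below a pending one: either below another entry of the queue,
    against the antichain property, or below one of its own children, which is too deep. This holds
    for every word [a], without reference to a configuration. *)
Lemma cylinder_nodup d q a :
  (2 <= d)%nat -> Forall (fun x => (x <= d)%nat) a -> q <> [] -> antichain q ->
  NoDup (map fst (cylinder d q a)).
Proof.
  intros Hd; revert q; induction a as [| x a IH]; intros q Ha Hq Hac; [constructor |].
  inversion Ha as [| x' a' Hx Ha']; subst.
  destruct q as [| v q]; [contradiction |].
  assert (Hne := expand_nonempty d x _ Hd Hx Hq).
  cbn [cylinder map fst hd]; constructor.
  - intros Hv; destruct (cylinder_descends d _ a v Hd Ha' Hne Hv) as [w [Hw Hwv]].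
    apply in_expand in Hw; [| exact Hx].
    destruct Hw as [Hw | [i [_ ->]]].
    + destruct Hac as [Hnd Hac]; inversion Hnd as [| v' q' Hnv _]; subst.
      apply Hnv; rewrite <- (Hac w v (in_cons _ _ _ Hw) (in_eq _ _) Hwv); exact Hw.
    + apply descends_length in Hwv; simpl in Hwv; lia.
  - apply IH; [assumption | assumption | apply antichain_expand; assumption].
Qed.

Lemma cylinder_valid d q a :
  (2 <= d)%nat -> Forall (fun x => (x <= d)%nat) a -> q <> [] -> Forall (valid d) q ->
  Forall (valid d) (map fst (cylinder d q a)).
Proof.
  intros Hd; revert q; induction a as [| x a IH]; intros q Ha Hq Hv; [constructor |].
  inversion Ha as [| x' a' Hx Ha']; subst.
  destruct q as [| v q]; [contradiction |].
  cbn [cylinder map fst hd]; constructor.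
  - inversion Hv; assumption.
  - apply IH; [assumption | apply expand_nonempty; assumption | apply valid_expand; assumption].
Qed.

(** As long as the labels read agree with [a], the queue driven by [c] and the one driven by [a]
    coincide. Thus an event about randomly chosen vertices becomes one about fixed vertices. *)
Lemma cylinder_labels d c q a :
  Forall (fun p => c (fst p) = snd p) (cylinder d q a) <->
  map (fun i => c (hd [] (queue d c i q))) (seq 0 (length a)) = a.
Proof.
  revert q; induction a as [| x a IH]; intros q; [simpl; split; [reflexivity | constructor] |].
  cbn [cylinder length seq map]; rewrite Forall_cons_iff, <- seq_shift, map_map; cbn [fst snd].
  change (queue d c 0 q) with q.
  assert (E : map (fun i => c (hd [] (queue d c (S i) q))) (seq 0 (length a))
              = map (fun i => c (hd [] (queue d c i (expand_by d c q)))) (seq 0 (length a))).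
  { apply map_ext; intros i; unfold queue; rewrite Nat.iter_succ_r; reflexivity. }
  rewrite E; split.
  - intros [<- H]; f_equal; apply IH; exact H.
  - intros H; injection H as Hx H; split; [exact Hx |].
    unfold expand_by in H; rewrite Hx in H; apply IH; exact H.
Qed.

(** * Counting along the exploration of a fixed configuration *)

Section Exploration.

Context {d : nat} {c : config}.
Hypothesis d_ge2 : (2 <= d)%nat.
Hypothesis c_le : forall v, (c v <= d)%nat.

Lemma queue_S n q : queue d c (S n) q = expand d (c (hd [] (queue d c n q))) (queue d c n q).
Proof. reflexivity. Qed.

Lemma queue_nonempty n : queue d c n [[]] <> [].
Proof.
  induction n as [| n IH]; [discriminate |].
  rewrite queue_S; apply expand_nonempty; auto.
Qed.

Lemma queue_head n : exists t, queue d c n [[]] = explored d c n :: t.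
Proof.
  assert (H := queue_nonempty n); unfold explored.
  destruct (queue d c n [[]]) as [| v t]; [contradiction | exists t; reflexivity].
Qed.

Lemma queue_length n : (length (queue d c n [[]]) + n = 1 + d * n)%nat.
Proof.
  induction n as [| n IH]; [simpl; lia |].
  rewrite queue_S; destruct (queue_head n) as [t E]; rewrite E in *.
  rewrite length_expand by apply c_le; simpl in *; lia.
Qed.

Lemma queue_valid n : Forall (valid d) (queue d c n [[]]).
Proof.
  induction n as [| n IH]; [repeat constructor |].
  rewrite queue_S; apply valid_expand; auto.
Qed.

Lemma label_le n : (label d c n <= d)%nat.
Proof. apply c_le. Qed.

Lemma label_sum_S n : label_sum d c (S n) = (label_sum d c n + label d c n)%nat.
Proof.
  unfold label_sum; rewrite seq_S, map_app, list_sum_app; simpl; lia.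
Qed.

Lemma label_sum_add_le m j : (label_sum d c (m + j) <= label_sum d c m + d * j)%nat.
Proof.
  induction j as [| j IH]; [rewrite Nat.add_0_r; lia |].
  rewrite Nat.add_succ_r, label_sum_S; assert (H := label_le (m + j)); lia.
Qed.

Definition explored_list (n : nat) : list vertex := map (explored d c) (seq 0 n).

Lemma in_explored_list n v :
  In v (explored_list n) <-> exists i, (i < n)%nat /\ v = explored d c i.
Proof.
  unfold explored_list; rewrite in_map_iff; split.
  - intros [i [<- Hi]]; apply in_seq in Hi; exists i; split; [lia | reflexivity].
  - intros [i [Hi ->]]; exists i; split; [reflexivity | apply in_seq; lia].
Qed.

Lemma cylinder_vertices q a :
  map (fun i => c (hd [] (queue d c i q))) (seq 0 (length a)) = a ->
  map fst (cylinder d q a) = map (fun i => hd [] (queue d c i q)) (seq 0 (length a)).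
Proof.
  revert q; induction a as [| x a IH]; intros q; [reflexivity |].
  cbn [cylinder length seq map]; rewrite <- seq_shift, !map_map; cbn [fst].
  change (queue d c 0 q) with q; intros H; injection H as Hx H.
  assert (E : forall i, queue d c (S i) q = queue d c i (expand d x q)).
  { intros i; unfold queue; rewrite Nat.iter_succ_r; f_equal.
    unfold expand_by; rewrite Hx; reflexivity. }
  rewrite IH.
  - f_equal; apply map_ext; intros i; rewrite E; reflexivity.
  - etransitivity; [| exact H]; apply map_ext; intros i; rewrite <- E; reflexivity.
Qed.

(** Transfers distinctness from prescribed words to the actual exploration. *)
Lemma explored_cylinder n :
  explored_list n = map fst (cylinder d [[]] (map (label d c) (seq 0 n))).
Proof.
  rewrite cylinder_vertices; rewrite length_map, length_seq; reflexivity.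
Qed.

Lemma antichain_root : antichain [[]].
Proof.
  split; [repeat constructor; intros [] |].
  intros u v [<- | []] [<- | []] _; reflexivity.
Qed.

Lemma explored_list_nodup n : NoDup (explored_list n).
Proof.
  rewrite explored_cylinder; apply cylinder_nodup;
    [exact d_ge2 | | discriminate | apply antichain_root].
  apply Forall_forall; intros x Hx; apply in_map_iff in Hx.
  destruct Hx as [i [<- _]]; apply label_le.
Qed.

Lemma explored_valid n : valid d (explored d c n).
Proof.
  assert (H := queue_valid n); destruct (queue_head n) as [t E]; rewrite E in H.
  inversion H; assumption.
Qed.

(** The queue is a frontier of the tree: replacing its head by all [d] children only uncovers the
    head itself, which has then been read. *)
Lemma explored_or_pending n v :
  valid d v -> In v (explored_list n) \/ exists u, In u (queue d c n [[]]) /\ descends u v.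
Proof.
  intros Hv; induction n as [| n IH].
  - right; exists []; split; [left; reflexivity | apply descends_root].
  - destruct IH as [IH | [u [Hu Huv]]].
    + left; apply in_explored_list in IH; destruct IH as [i [Hi ->]].
      apply in_explored_list; exists i; split; [lia | reflexivity].
    + rewrite queue_S; destruct (queue_head n) as [t E]; rewrite E in *.
      destruct Hu as [<- | Hu].
      * apply descends_through_child in Huv; destruct Huv as [-> | [i Hi]].
        -- left; apply in_explored_list; exists n; split; [lia | reflexivity].
        -- right; exists (i :: explored d c n); split; [| exact Hi].
           apply in_expand; [apply c_le | right].
           exists i; split; [| reflexivity].
           assert (H := descends_valid d _ _ Hi Hv); inversion H; assumption.
      * right; exists u; split; [| exact Huv].
        apply in_expand; [apply c_le | left; exact Hu].
Qed.

(* The first [m] explored vertices are those of level at most [k], and the pending ones are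
   exactly the vertices of level [k + 1] whose parent has level at most [k]. *)
Definition level_complete (k m : nat) : Prop :=
  Forall (fun u => level c u = S k) (queue d c m [[]]) /\
  forall i, (i < m)%nat -> (level c (explored d c i) <= k)%nat.

Lemma level_complete_0 : level_complete 0 0.
Proof. split; [repeat constructor | intros i Hi; inversion Hi]. Qed.

(** Levels do not decrease downwards, so a vertex below a pending one has level at least [k + 1];
    all others have been read. *)
Lemma level_complete_explored k m v :
  level_complete k m -> In v (explored_list m) <-> valid d v /\ (level c v <= k)%nat.
Proof.
  intros [Hq He]; split.
  - intros H; apply in_explored_list in H; destruct H as [i [Hi ->]].
    split; [apply explored_valid | apply He; exact Hi].
  - intros [Hv Hk]; destruct (explored_or_pending m v Hv) as [H | [u [Hu Huv]]]; [exact H |].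
    exfalso; apply level_mono with (c := c) in Huv.
    rewrite (proj1 (Forall_forall _ _) Hq u Hu) in Huv; lia.
Qed.

(** The state [j] steps into level [k + 1]: [cur] is what remains of that level and [nxt] what has
    been collected for the following one. The last equation says that each step changes [length cur]
    by [d - 1] minus the label read, arranged to avoid subtraction. *)
Definition partial_level (k m j : nat) (cur nxt : list vertex) : Prop :=
  queue d c (m + j) [[]] = cur ++ nxt /\
  Forall (fun u => level c u = S k) cur /\
  Forall (fun u => level c u = S (S k)) nxt /\
  (forall i, (i < m + j)%nat -> (level c (explored d c i) <= S k)%nat) /\
  (length cur + label_sum d c (m + j) + j
   = length (queue d c m [[]]) + label_sum d c m + d * j)%nat.

Lemma partial_level_step k m j v cur nxt :
  partial_level k m j (v :: cur) nxt ->
  partial_level k m (S j) (map (fun i => i :: v) (seq (c v) (d - c v)) ++ cur)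
                          (nxt ++ map (fun i => i :: v) (seq 0 (c v))).
Proof.
  intros [Hq [Hcur [Hnxt [He Hl]]]].
  inversion Hcur as [| v' cur' Hv Hcur']; subst.
  assert (Ev : explored d c (m + j) = v) by (unfold explored; rewrite Hq; reflexivity).
  repeat split.
  - rewrite Nat.add_succ_r, queue_S, Hq; simpl; rewrite !app_assoc; reflexivity.
  - apply Forall_app; split; [| exact Hcur'].
    apply Forall_forall; intros u Hu; apply in_map_iff in Hu; destruct Hu as [i [<- Hi]].
    apply in_seq in Hi; simpl; rewrite Hv.
    destruct (Nat.ltb_spec i (c v)); lia.
  - apply Forall_app; split; [exact Hnxt |].
    apply Forall_forall; intros u Hu; apply in_map_iff in Hu; destruct Hu as [i [<- Hi]].
    apply in_seq in Hi; simpl; rewrite Hv.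
    destruct (Nat.ltb_spec i (c v)); lia.
  - intros i Hi; destruct (Nat.eq_dec i (m + j)) as [-> | Hne]; [rewrite Ev, Hv; lia |].
    apply He; lia.
  - rewrite (Nat.add_succ_r m j), label_sum_S, length_app, length_map, length_seq.
    unfold label; rewrite Ev; assert (Hc := c_le v); simpl in Hl; unfold vertex in *; lia.
Qed.

(** Purely combinatorial: either the level ends at some time, or it is still running after the given
    [j] steps. The drift enters only afterwards. *)
Lemma level_progress k m j :
  level_complete k m ->
  (exists j' nxt, partial_level k m j' [] nxt) \/
  (exists v cur nxt, partial_level k m j (v :: cur) nxt).
Proof.
  intros [Hq He]; induction j as [| j IH].
  - right; destruct (queue_head m) as [t E]; exists (explored d c m), t, [].
    repeat split; rewrite ?Nat.add_0_r, ?app_nil_r, <- ?E;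
      [reflexivity | exact Hq | constructor | | lia].
    intros i Hi; assert (H := He i Hi); lia.
  - destruct IH as [IH | [v [cur [nxt H]]]]; [left; exact IH |].
    apply partial_level_step in H.
    destruct (map (fun i => i :: v) (seq (c v) (d - c v)) ++ cur) as [| u cur'].
    + left; exists (S j); eexists; exact H.
    + right; exists u, cur'; eexists; exact H.
Qed.

Lemma level_complete_next k m :
  (forall C, exists N, forall n, (N <= n)%nat -> (C + d * n <= label_sum d c n + n)%nat) ->
  level_complete k m ->
  exists m', level_complete (S k) m' /\ (2 * m + 1 <= m')%nat /\
             (label_sum d c m' + m' = label_sum d c m + d * m' + 1)%nat.
Proof.
  intros Hdrift Hk.
  assert (Hl := queue_length m).
  (* With this constant the labels read up to step [m + N] are too large for a vertex of the level
     to be left, since [length cur] would be negative. *)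
  destruct (Hdrift (length (queue d c m [[]]) + label_sum d c m)%nat) as [N HN].
  destruct (level_progress k m N Hk) as [[j [nxt [Hq [_ [Hnxt [He Hj]]]]]] |
                                         [v [cur [nxt [_ [_ [_ [_ Hj]]]]]]]].
  - exists (m + j)%nat; split; [split; [rewrite Hq; exact Hnxt | exact He] |].
    (* Labels are at most [d], so emptying the level takes at least as many steps as there were
       pending vertices: [j >= 1 + (d - 1) * m >= m + 1]. *)
    assert (H := label_sum_add_le m j); simpl in Hj.
    split; nia.
  - exfalso; specialize (HN (m + N)%nat ltac:(lia)); simpl in Hj; nia.
Qed.

End Exploration.

(** * Excursions of the rotor walk *)

Definition parent (v : vertex) : option vertex :=
  match v with [] => None | _ :: t => Some t end.

Definition set_rotor (s : config) (v : vertex) (k : nat) : config :=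
  fun u => if list_eq_dec Nat.eq_dec u v then k else s u.

Lemma set_rotor_eq s v k : set_rotor s v k v = k.
Proof. unfold set_rotor; destruct list_eq_dec; congruence. Qed.

Lemma set_rotor_neq s v k u : u <> v -> set_rotor s v k u = s u.
Proof. intros H; unfold set_rotor; destruct list_eq_dec; congruence. Qed.

(** The increment of the rotor and the 0-based child index cancel: the old rotor value is the index
    of the child entered. *)
Lemma rotor_step_down d s v :
  (s v < d)%nat -> rotor_step d (Some v, s) = (Some (s v :: v), set_rotor s v (S (s v))).
Proof.
  intros H; unfold rotor_step; cbn [fst snd].
  rewrite Nat.mod_small by lia.
  replace (s v + 1)%nat with (S (s v)) by lia; cbn [Nat.eqb].
  rewrite Nat.sub_1_r; reflexivity.
Qed.

Lemma rotor_step_up d s v :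
  s v = d -> rotor_step d (Some v, s) = (parent v, set_rotor s v 0).
Proof.
  intros H; unfold rotor_step; cbn [fst snd].
  rewrite H, Nat.Div0.mod_same; reflexivity.
Qed.

(** Only the set of elements of [l] matters, and the final position is not counted, so that
    consecutive pieces of a trajectory concatenate; it may be the sink. *)
Definition passes (d n : nat) (l : list vertex) (s s' : state) : Prop :=
  Nat.iter n (rotor_step d) s = s' /\
  (forall i, (i < n)%nat -> exists v, In v l /\ fst (Nat.iter i (rotor_step d) s) = Some v) /\
  (forall v, In v l -> exists i, (i < n)%nat /\ fst (Nat.iter i (rotor_step d) s) = Some v).

Lemma passes_step d v s : passes d 1 [v] (Some v, s) (rotor_step d (Some v, s)).
Proof.
  split; [reflexivity | split].
  - intros i Hi; exists v; replace i with 0%nat by lia; split; [left |]; reflexivity.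
  - intros u [<- | []]; exists 0%nat; split; [lia | reflexivity].
Qed.

Lemma passes_trans d n n' l l' s s' s'' :
  passes d n l s s' -> passes d n' l' s' s'' -> passes d (n + n') (l ++ l') s s''.
Proof.
  intros [E [H1 H2]] [E' [H1' H2']]; split; [| split].
  - rewrite Nat.add_comm, Nat.iter_add, E; exact E'.
  - intros i Hi; destruct (lt_dec i n) as [Hin | Hin].
    + destruct (H1 i Hin) as [v [Hv Ev]]; exists v; split; [apply in_app_iff; left |]; assumption.
    + destruct (H1' (i - n)%nat ltac:(lia)) as [v [Hv Ev]]; exists v.
      split; [apply in_app_iff; right; exact Hv |].
      rewrite <- E, <- Nat.iter_add in Ev.
      replace (i - n + n)%nat with i in Ev by lia; exact Ev.
  - intros v Hv; apply in_app_iff in Hv; destruct Hv as [Hv | Hv].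
    + destruct (H2 v Hv) as [i [Hi Ei]]; exists i; split; [lia | exact Ei].
    + destruct (H2' v Hv) as [i [Hi Ei]]; exists (i + n)%nat; split; [lia |].
      rewrite Nat.iter_add, E; exact Ei.
Qed.

Lemma passes_ext d n l l' s s' :
  (forall v, In v l <-> In v l') -> passes d n l s s' -> passes d n l' s s'.
Proof.
  intros H [E [H1 H2]]; split; [exact E | split].
  - intros i Hi; destruct (H1 i Hi) as [v [Hv Ev]]; exists v.
    split; [apply H; exact Hv | exact Ev].
  - intros v Hv; apply H2, H; exact Hv.
Qed.

(** * Return times and visited vertices *)

Lemma X_add d c n i : X d c (n + i) = fst (Nat.iter i (rotor_step d) (rotor_state d c n)).
Proof. unfold X, rotor_state; rewrite Nat.add_comm, Nat.iter_add; reflexivity. Qed.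

Lemma returns_add d c n j :
  (forall i, (1 <= i <= j)%nat -> X d c (n + i) <> None) ->
  returns d c (n + j) = returns d c n.
Proof.
  intros H; induction j as [| j IH]; [rewrite Nat.add_0_r; reflexivity |].
  rewrite Nat.add_succ_r; simpl.
  rewrite IH by (intros i Hi; apply H; lia).
  assert (Hj := H (S j) ltac:(lia)); rewrite Nat.add_succ_r in Hj.
  destruct (X d c (S (n + j))); [reflexivity | contradiction].
Qed.

Lemma in_visited d c n v :
  In v (visited d c n) <-> exists i, (i <= n)%nat /\ X d c i = Some v.
Proof.
  assert (Hs : forall x, In v (sites x) <-> x = Some v).
  { intros [u |]; simpl; split; [intros [-> | []]; reflexivity | | tauto | discriminate].
    intros E; injection E as ->; left; reflexivity. }
  induction n as [| n IH]; cbn [visited].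
  - rewrite Hs; split; [intros E; exists 0%nat; split; [lia | exact E] |].
    intros [i [Hi E]]; replace i with 0%nat in E by lia; exact E.
  - rewrite in_app_iff, Hs, IH; split.
    + intros [E | [i [Hi E]]]; [exists (S n) | exists i]; (split; [lia | exact E]).
    + intros [i [Hi E]]; destruct (Nat.eq_dec i (S n)) as [-> | Hne]; [left; exact E | right].
      exists i; split; [lia | exact E].
Qed.

Lemma length_nodup_same_elements (l l' : list vertex) :
  NoDup l' -> (forall v, In v l <-> In v l') ->
  length (nodup (list_eq_dec Nat.eq_dec) l) = length l'.
Proof.
  intros Hnd H; apply Permutation_length, NoDup_Permutation; [apply NoDup_nodup | exact Hnd |].
  intros v; rewrite nodup_In; apply H.
Qed.

Lemma lengths_bounded (l : list vertex) :
  exists M, forall v, In v l -> (length v <= M)%nat.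
Proof.
  induction l as [| u l [M HM]]; [exists 0%nat; intros v [] |].
  exists (max (length u) M); intros v [-> | Hv]; [lia |].
  assert (H := HM v Hv); lia.
Qed.

(** * One excursion and its iteration *)

Section Walk.

Context {d : nat} {c : config}.
Hypothesis d_ge2 : (2 <= d)%nat.
Hypothesis c_le : forall v, (c v <= d)%nat.

(* The rotors below [v] after [k] completed excursions from the sink. *)
Definition rotors_after (k : nat) (s : config) (v : vertex) : Prop :=
  forall u, valid d u -> descends v u -> s u = if (level c u <=? k)%nat then 0%nat else c u.

(** The walk starts at [v] and ends at its parent: the edge above [v] is crossed once, the edge
    above every other vertex of [l] twice, whence [n + 1 = 2 * length l]. *)
Definition excursion (k : nat) (v : vertex) (s : config)
  (n : nat) (l : list vertex) (s' : config) : Prop :=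
  passes d n l (Some v, s) (parent v, s') /\
  (n + 1 = 2 * length l)%nat /\
  NoDup l /\
  (forall u, In u l <-> valid d u /\ descends v u /\ (level c u <= S k)%nat) /\
  (forall u, In u l -> s' u = 0%nat) /\
  (forall u, ~ In u l -> s' u = s u).

(** Induction on the number [r] of children still to be entered before the walk leaves [v] upwards.
    Excursions below the children are a hypothesis, which keeps this induction apart from the one on
    depth. *)
Lemma excursion_children k v :
  (forall i s, (i < d)%nat -> (level c (i :: v) <= S k)%nat -> rotors_after k s (i :: v) ->
     exists n l s', excursion k (i :: v) s n l s') ->
  forall r s, (s v + r = d)%nat ->
  (forall i, (s v <= i < d)%nat -> (level c (i :: v) <= S k)%nat /\ rotors_after k s (i :: v)) ->
  exists n l s',
    passes d n (v :: l) (Some v, s) (parent v, s') /\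
    n = (2 * length l + 1)%nat /\
    NoDup l /\
    (forall u, In u l <-> exists i, (s v <= i < d)%nat /\
       valid d u /\ descends (i :: v) u /\ (level c u <= S k)%nat) /\
    (forall u, In u (v :: l) -> s' u = 0%nat) /\
    (forall u, ~ In u (v :: l) -> s' u = s u).
Proof.
  intros Hchild; induction r as [| r IH]; intros s Hr Hs.
  - exists 1%nat, [], (set_rotor s v 0).
    rewrite <- (rotor_step_up d) by lia.
    split; [apply passes_step |].
    split; [reflexivity |].
    split; [constructor |].
    split; [intros u; split; [intros [] | intros [i [Hi _]]; lia] |].
    split.
    + intros u [<- | []]; apply set_rotor_eq.
    + intros u Hu; apply set_rotor_neq; intros ->; apply Hu; left; reflexivity.
  - set (j := s v) in *.
    assert (Hout : forall i u, descends (i :: v) u -> u <> v).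
    { intros i u Hu ->; apply descends_length in Hu; simpl in Hu; lia. }
    set (s1 := set_rotor s v (S j)).
    assert (H1 : forall i u, descends (i :: v) u -> s1 u = s u)
      by (intros i u Hu; apply set_rotor_neq; exact (Hout i u Hu)).
    destruct (Hs j ltac:(lia)) as [Hlj Hrj].
    destruct (Hchild j s1 ltac:(lia) Hlj) as [n1 [l1 [s2 [Hp [Hn1 [Hnd1 [Hl1 [Hz1 Hk1]]]]]]]].
    { intros u Hu Hd; rewrite (H1 j u Hd); exact (Hrj u Hu Hd). }
    assert (Hv1 : ~ In v l1)
      by (intros H; apply Hl1 in H; exact (Hout j v (proj1 (proj2 H)) eq_refl)).
    assert (Hs2v : s2 v = S j) by (rewrite Hk1 by exact Hv1; apply set_rotor_eq).
    destruct (IH s2) as [n2 [l2 [s3 [Hp2 [Hn2 [Hnd2 [Hl2 [Hz2 Hk2]]]]]]]].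
    { lia. }
    (* The subtrees of distinct children are disjoint, so the excursion into child [j] leaves the
       rotors below later children unchanged. *)
    { rewrite Hs2v; intros i Hi; destruct (Hs i ltac:(lia)) as [Hli Hri].
      split; [exact Hli |].
      intros u Hu Hd; rewrite Hk1, (H1 i u Hd); [exact (Hri u Hu Hd) |].
      intros H; apply Hl1 in H.
      assert (E := descends_child_unique _ _ _ _ Hd (proj1 (proj2 H))); lia. }
    rewrite Hs2v in Hl2.
    exists (1 + (n1 + n2))%nat, (l1 ++ l2), s3.
    split; [| split; [| split; [| split; [| split]]]].
    (* The trajectory comes back to [v] between the children; as a set this adds nothing. *)
    + apply passes_ext with ([v] ++ (l1 ++ (v :: l2))).
      * intros u; rewrite !in_app_iff; simpl; rewrite in_app_iff; tauto.
      * apply passes_trans with (2 := passes_trans _ _ _ _ _ _ _ _ Hp Hp2).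
        unfold s1, j; rewrite <- (rotor_step_down d) by (fold j; lia); apply passes_step.
    + unfold vertex in *; rewrite length_app; lia.
    + apply NoDup_app; [exact Hnd1 | exact Hnd2 |].
      intros u Hu1 Hu2; apply Hl1 in Hu1; apply Hl2 in Hu2.
      destruct Hu2 as [i [Hi [_ [Hd _]]]].
      assert (E := descends_child_unique _ _ _ _ Hd (proj1 (proj2 Hu1))); lia.
    + intros u; rewrite in_app_iff, Hl1, Hl2; split.
      * intros [H | [i [Hi H]]]; [exists j | exists i]; (split; [lia | exact H]).
      * intros [i [Hi H]]; destruct (Nat.eq_dec i j) as [-> | Hne]; [left; exact H | right].
        exists i; split; [lia | exact H].
    + intros u Hu; destruct (classic (In u (v :: l2))) as [Hu2 | Hu2]; [apply Hz2; exact Hu2 |].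
      rewrite Hk2 by exact Hu2; apply Hz1.
      simpl in Hu, Hu2; rewrite in_app_iff in Hu; tauto.
    + intros u Hu; simpl in Hu; rewrite in_app_iff in Hu.
      rewrite Hk2 by (simpl; tauto); rewrite Hk1 by tauto.
      apply set_rotor_neq; intros ->; tauto.
Qed.

(** Induction on the fuel [f]: vertices of level at most [k + 1] have depth at most [M], so the
    recursion into children stops and the case [f = 0] is contradictory. *)
Lemma excursion_exists k M :
  (forall u, valid d u -> (level c u <= S k)%nat -> (length u <= M)%nat) ->
  forall f v s, (M < length v + f)%nat -> valid d v -> (level c v <= S k)%nat ->
  rotors_after k s v -> exists n l s', excursion k v s n l s'.
Proof.
  intros HM f; induction f as [| f IH]; intros v s Hf Hv Hlv Hs.
  { assert (H := HM v Hv Hlv); lia. }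
  assert (Hsv := Hs v Hv (descends_refl v)).
  assert (Hle : (s v <= d)%nat) by (rewrite Hsv; destruct Nat.leb; [lia | apply c_le]).
  (* The children entered are exactly those of level at most [k + 1]. If [v] was visited before, its
     rotor is 0 and all children qualify; otherwise [v] has level [k + 1], its rotor is still [c v],
     and the children of index at least [c v] keep its level. *)
  assert (Hlow : forall i, (s v <= i)%nat <-> (level c (i :: v) <= S k)%nat).
  { intros i; simpl; rewrite Hsv.
    destruct (Nat.leb_spec (level c v) k), (Nat.ltb_spec i (c v)); lia. }
  destruct (excursion_children k v) with (r := (d - s v)%nat) (s := s)
    as [n [l [s' [Hp [Hn [Hnd [Hl [Hz Hk]]]]]]]].
  - intros i t Hi Hli Ht; apply IH; [simpl; lia | constructor; assumption | exact Hli | exact Ht].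
  - lia.
  - intros i Hi; split; [apply Hlow; lia |].
    intros u Hu Hd; apply Hs; [exact Hu | exact (descends_trans _ _ _ (descends_child v i) Hd)].
  - exists n, (v :: l), s'.
    split; [exact Hp | split; [unfold vertex in *; simpl; lia | split; [| split; [| split; assumption]]]].
    + constructor; [| exact Hnd]; intros H; apply Hl in H; destruct H as [i [_ [_ [Hd _]]]].
      apply descends_length in Hd; simpl in Hd; lia.
    + intros u; split.
      * intros [<- | H]; [split; [exact Hv | split; [apply descends_refl | exact Hlv]] |].
        apply Hl in H; destruct H as [i [_ [Hu [Hd Hlu]]]].
        split; [exact Hu | split; [| exact Hlu]].
        exact (descends_trans _ _ _ (descends_child v i) Hd).
      * intros [Hu [Hd Hlu]]; assert (Hd' := Hd); apply descends_through_child in Hd'.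
        destruct Hd' as [-> | [i Hi]]; [left; reflexivity | right].
        assert (Hvi := descends_valid d _ _ Hi Hu); inversion Hvi; subst.
        assert (Hli := level_mono c _ _ Hi).
        apply Hl; exists i; split; [split; [apply Hlow; lia | assumption] |].
        split; [exact Hu | split; [exact Hi | exact Hlu]].
Qed.

(* [b] is the time at which excursion number [k + 1] starts at the root; the sink was left
   at time [b - 1] unless [k = 0]. *)
Definition excursion_start (k m b : nat) : Prop :=
  level_complete (d := d) (c := c) k m /\
  (exists s, rotor_state d c b = (Some [], s) /\ rotors_after k s []) /\
  (forall v, (exists i, (i < b)%nat /\ X d c i = Some v) <-> valid d v /\ (level c v <= k)%nat) /\
  returns d c b = k /\
  ((1 <= k)%nat -> (1 <= b)%nat /\ X d c (b - 1) = None) /\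
  (d * b + 2 * k = 2 * label_sum d c m + b)%nat /\
  (2 ^ k <= m + 1)%nat.

Lemma excursion_start_0 : excursion_start 0 0 0.
Proof.
  split; [apply level_complete_0 |].
  split.
  { exists c; split; [reflexivity |].
    intros u _ _; assert (H := level_pos c u); destruct (Nat.leb_spec (level c u) 0); lia. }
  split.
  { intros v; assert (H := level_pos c v); split; [intros [i [Hi _]]; inversion Hi | lia]. }
  split; [reflexivity |].
  split; [intros H; inversion H |].
  split; [unfold label_sum; simpl; lia | apply le_n].
Qed.

Lemma excursion_start_next k m b :
  (forall C, exists N, forall n, (N <= n)%nat -> (C + d * n <= label_sum d c n + n)%nat) ->
  excursion_start k m b -> exists m' b', excursion_start (S k) m' b'.
Proof.
  intros Hdrift [Hm [[s [Es Hs]] [Hvis [Hret [Hsink [Hb Hpow]]]]]].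
  destruct (level_complete_next d_ge2 c_le k m Hdrift Hm) as [m' [Hm' [Hmm' Hsum]]].
  assert (Hex := level_complete_explored d_ge2 c_le (S k) m').
  destruct (lengths_bounded (explored_list (d := d) (c := c) m')) as [M HM].
  destruct (excursion_exists k M) with (f := S M) (v := @nil nat) (s := s)
    as [n [l [s' [Hp [Hn [Hnd [Hl [Hz Hkeep]]]]]]]].
  { intros u Hu Hlu; apply HM, Hex; [exact Hm' | split; assumption]. }
  { simpl; lia. }
  { constructor. }
  { simpl; lia. }
  { exact Hs. }
  (* The excursion from the root and the exploration both collect the vertices of level at most
     [k + 1]; this ties the walk to the queue. *)
  assert (Hlen : length l = m').
  { transitivity (length (explored_list (d := d) (c := c) m')).
    - apply Permutation_length, NoDup_Permutation;
        [exact Hnd | apply explored_list_nodup; assumption |].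
      intros u; rewrite Hl, Hex by exact Hm'; split; [tauto |].
      intros H; split; [tauto | split; [apply descends_root | tauto]].
    - unfold explored_list; rewrite length_map, length_seq; reflexivity. }
  destruct Hp as [Hp [Hp1 Hp2]]; cbn [parent] in Hp.
  assert (HX : forall i, X d c (b + i) = fst (Nat.iter i (rotor_step d) (Some [], s)))
    by (intros i; rewrite X_add, Es; reflexivity).
  assert (Hend : X d c (b + n) = None) by (rewrite HX; exact (f_equal fst Hp)).
  assert (Hstate : rotor_state d c (b + n + 1) = (Some [], s')).
  { unfold rotor_state in *; replace (b + n + 1)%nat with (1 + (n + b))%nat by lia.
    rewrite !Nat.iter_add, Es; exact (f_equal (rotor_step d) Hp). }
  (* The sink is reached at time [b + n], and one further step leads back to the root. *)
  exists m', (b + n + 1)%nat.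
  split; [exact Hm' |].
  split.
  { exists s'; split; [exact Hstate |].
    intros u Hu Hd; destruct (Nat.leb_spec (level c u) (S k)) as [Hlu | Hlu].
    - apply Hz, Hl; tauto.
    - rewrite Hkeep by (intros H; apply Hl in H; lia).
      rewrite (Hs u Hu Hd); destruct (Nat.leb_spec (level c u) k); lia. }
  split.
  { intros v; split.
    - intros [i [Hi Ei]]; destruct (lt_dec i b) as [Hib | Hib].
      + assert (H : valid d v /\ (level c v <= k)%nat) by (apply Hvis; exists i; split; assumption).
        split; [tauto | lia].
      + replace i with (b + (i - b))%nat in Ei by lia.
        destruct (Nat.eq_dec (i - b) n) as [E | E]; [rewrite E in Ei; congruence |].
        destruct (Hp1 (i - b)%nat ltac:(lia)) as [u [Hu Eu]].
        rewrite HX in Ei; assert (E' := eq_trans (eq_sym Eu) Ei); injection E' as ->; apply Hl in Hu; tauto.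
    - intros [Hv Hlv]; destruct (Hp2 v) as [i [Hi Ei]].
      + apply Hl; split; [exact Hv | split; [apply descends_root | exact Hlv]].
      + exists (b + i)%nat; split; [lia | rewrite HX; exact Ei]. }
  split.
  { replace (b + n + 1)%nat with (S (S (b + (n - 1)))) by lia.
    cbn [returns].
    replace (S (S (b + (n - 1)))) with (b + n + 1)%nat by lia.
    replace (S (b + (n - 1))) with (b + n)%nat by lia.
    rewrite Hend; unfold X at 1; rewrite Hstate; cbn [fst].
    rewrite returns_add, Hret; [reflexivity |].
    intros i Hi; destruct (Hp1 i ltac:(lia)) as [u [_ Eu]].
    intros E; rewrite HX in E; discriminate (eq_trans (eq_sym Eu) E). }
  split.
  { intros _; split; [lia |].
    replace (b + n + 1 - 1)%nat with (b + n)%nat by lia; exact Hend. }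
  (* Here [b] grows by [n + 1 = 2 * m'], which with the recursion for the label sums preserves the
     identity; the power bound follows from [2 * m + 1 <= m']. *)
  split; [nia | simpl; lia].
Qed.

Lemma excursion_start_return k m b : excursion_start k m b -> is_return_time d c k (b - 1).
Proof.
  intros [_ [[s [Es _]] [Hvis [Hret [Hsink _]]]]].
  (* For [b = 0] truncated subtraction gives time 0, the convention for return number 0. *)
  destruct b as [| b].
  - left; split; [| reflexivity].
    destruct k as [| k]; [reflexivity | destruct (Hsink ltac:(lia)); lia].
  - destruct k as [| k].
    + exfalso; destruct (proj1 (Hvis [])) as [_ H]; [| simpl in H; lia].
      exists 0%nat; split; [lia | reflexivity].
    + destruct (Hsink ltac:(lia)) as [_ Hnone]; right.
      split; [lia | split; [exact Hnone |]].
      rewrite Nat.sub_1_r; cbn [returns Nat.pred] in *.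
      unfold X in Hret at 1; rewrite Es in Hret; exact Hret.
Qed.

(** For [k = 0] this would fail: the range at time 0 already contains the root, while [m = 0]. *)
Lemma excursion_start_range k m b :
  (1 <= k)%nat -> excursion_start k m b -> range_card d c (b - 1) = m.
Proof.
  intros Hk [Hm [_ [Hvis [_ [Hsink _]]]]]; destruct (Hsink Hk) as [Hb _].
  unfold range_card.
  rewrite (length_nodup_same_elements _ (explored_list (d := d) (c := c) m)).
  - unfold explored_list; rewrite length_map, length_seq; reflexivity.
  - apply explored_list_nodup; assumption.
  - intros v; rewrite in_visited, (level_complete_explored d_ge2 c_le k m v Hm), <- Hvis.
    split; intros [i [Hi E]]; exists i; (split; [lia | exact E]).
Qed.

End Walk.

(** * The law of the explored rotors *)

Lemma Rabs_le_bounds x y : Rabs x <= y -> - y <= x <= y.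
Proof. intros H; unfold Rabs in H; destruct Rcase_abs; lra. Qed.

(** From [exp (- y) >= 1 - y] one gets [exp y <= / (1 - y)], and [(1 + y + 2 * y ^ 2) * (1 - y) = 1
    + y ^ 2 * (1 - 2 * y) >= 1]. *)
Lemma exp_le_quadratic y : -/2 <= y <= /2 -> exp y <= 1 + y + 2 * y ^ 2.
Proof.
  intros Hy.
  assert (H1 := exp_ineq1_le (- y)).
  assert (H2 : exp y * exp (- y) = 1) by (rewrite <- exp_plus, Rplus_opp_r; apply exp_0).
  assert (H0 := exp_pos y).
  apply Rmult_le_reg_r with (1 - y); [lra |].
  apply Rle_trans with 1; nra.
Qed.

Lemma bounded_on_initial_segment (f : nat -> R) n :
  exists B, 0 < B /\ forall x, (x <= n)%nat -> Rabs (f x) <= B.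
Proof.
  induction n as [| n [B [HB H]]].
  - exists (1 + Rabs (f 0%nat)); assert (H := Rabs_pos (f 0%nat)).
    split; [lra |]; intros x Hx; replace x with 0%nat by lia; lra.
  - assert (H1 := Rabs_pos (f (S n))); exists (B + Rabs (f (S n))); split; [lra |].
    intros x Hx; destruct (Nat.eq_dec x (S n)) as [-> | Hne]; [lra |].
    assert (H2 := H x ltac:(lia)); lra.
Qed.

Definition list_Rsum (f : nat -> R) (a : list nat) : R :=
  fold_right (fun x acc => f x + acc) 0 a.

Lemma list_Rsum_affine p q a :
  list_Rsum (fun x => p * INR x + q) a = p * INR (list_sum a) + q * INR (length a).
Proof.
  induction a as [| x a IH]; [simpl; ring |].
  cbn [list_Rsum fold_right length]; fold (list_Rsum (fun x => p * INR x + q) a).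
  change (list_sum (x :: a)) with (x + list_sum a)%nat.
  rewrite IH, plus_INR, S_INR; ring.
Qed.

(** * Exponential moments and the product law on words *)

Section Distribution.

Context {d : nat} {r : nat -> R}.
Hypothesis r_prob : prob_vector d r.

Lemma exponential_moment_lt_1 f :
  sum_f_R0 (fun x => r x * f x) d < 0 ->
  exists s, 0 < s /\ 0 <= sum_f_R0 (fun x => r x * exp (s * f x)) d < 1.
Proof.
  destruct r_prob as [Hr Hr1]; intros Hf.
  set (m := sum_f_R0 (fun x => r x * f x) d) in *.
  destruct (bounded_on_initial_segment f d) as [B [HB Hb]].
  (* The first bound keeps [s * f x] in the range of the quadratic estimate; the second makes the
     quadratic term at most half of the linear gain [- s * m]. *)
  set (s := Rmin (/ (2 * B)) (- m / (4 * B ^ 2))).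
  assert (HB2 : 0 < 4 * B ^ 2) by nra.
  assert (Hs : 0 < s).
  { apply Rmin_glb_lt; [apply Rinv_0_lt_compat; lra |].
    apply Rdiv_lt_0_compat; lra. }
  assert (Hs1 : s * B <= / 2).
  { apply Rle_trans with (/ (2 * B) * B); [apply Rmult_le_compat_r; [lra | apply Rmin_l] |].
    apply Req_le; field; lra. }
  assert (Hs2 : s * (4 * B ^ 2) <= - m).
  { apply Rle_trans with (- m / (4 * B ^ 2) * (4 * B ^ 2)).
    - apply Rmult_le_compat_r; [lra | apply Rmin_r].
    - apply Req_le; field; lra. }
  exists s; split; [exact Hs | split].
  { rewrite <- (Rmult_0_l (INR (S d))), <- sum_cte; apply sum_Rle; intros x Hx.
    assert (H0 := Hr x Hx); assert (H1 := exp_pos (s * f x)); nra. }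
  apply Rle_lt_trans with
    (sum_f_R0 (fun x => r x * (1 + 2 * (s * B) ^ 2) + r x * f x * s) d).
  - apply sum_Rle; intros x Hx.
    assert (H0 := Hr x Hx).
    assert (Hbx := Rabs_le_bounds _ _ (Hb x Hx)).
    assert (Hy : exp (s * f x) <= 1 + s * f x + 2 * (s * f x) ^ 2)
      by (apply exp_le_quadratic; nra).
    assert (Hsq : (s * f x) ^ 2 <= (s * B) ^ 2).
    { assert (s * f x <= s * B) by nra. assert (- (s * B) <= s * f x) by nra. nra. }
    nra.
  - rewrite sum_plus, <- !scal_sum, Hr1; fold m.
    nra.
Qed.

(** Expectation of [g] under the [n]-fold product of the law [r], as an iterated finite sum. *)
Fixpoint word_mean (n : nat) (g : list nat -> R) : R :=
  match n with
  | O => g []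
  | S m => sum_f_R0 (fun x => r x * word_mean m (fun a => g (x :: a))) d
  end.

Lemma word_mean_le n g h : (forall a, g a <= h a) -> word_mean n g <= word_mean n h.
Proof.
  revert g h; induction n as [| n IH]; intros g h H; [apply H |].
  simpl; apply sum_Rle; intros x Hx.
  apply Rmult_le_compat_l; [apply r_prob; exact Hx | apply IH; intros a; apply H].
Qed.

(** The factor [K] is there for the induction: it absorbs the exponential of the first letter. *)
Lemma word_mean_exp s f n K :
  word_mean n (fun a => K * exp (s * list_Rsum f a))
  = K * sum_f_R0 (fun x => r x * exp (s * f x)) d ^ n.
Proof.
  revert K; induction n as [| n IH]; intros K.
  - simpl; rewrite Rmult_0_r, exp_0; ring.
  - cbn [word_mean].
    rewrite (sum_eq _ (fun x => r x * exp (s * f x)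
                                * (K * sum_f_R0 (fun x => r x * exp (s * f x)) d ^ n))).
    + rewrite <- scal_sum; simpl; ring.
    + intros x _; rewrite Rmult_assoc; f_equal.
      rewrite (Rmult_comm (exp _)), Rmult_assoc, (Rmult_comm _ (exp _)), <- Rmult_assoc, <- IH.
      f_equal; extensionality a; cbn [list_Rsum fold_right]; fold (list_Rsum f a).
      rewrite Rmult_plus_distr_l, exp_plus; ring.
Qed.

(** The indicator of [0 <= list_Rsum f a] is at most [exp (s * list_Rsum f a)]. *)
Lemma chernoff s f n :
  0 < s ->
  word_mean n (fun a => if excluded_middle_informative (0 <= list_Rsum f a) then 1 else 0)
  <= sum_f_R0 (fun x => r x * exp (s * f x)) d ^ n.
Proof.
  intros Hs; rewrite <- (Rmult_1_l (_ ^ n)), <- word_mean_exp.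
  apply word_mean_le; intros a; rewrite Rmult_1_l.
  assert (H := exp_pos (s * list_Rsum f a)).
  destruct excluded_middle_informative as [H0 | _]; [| lra].
  assert (H1 := exp_ineq1_le (s * list_Rsum f a)); nra.
Qed.

End Distribution.

Definition word_weight (r : nat -> R) (a : list nat) : R :=
  fold_right (fun x acc => r x * acc) 1 a.

Lemma word_weight_snoc r a x : word_weight r (a ++ [x]) = word_weight r a * r x.
Proof.
  unfold word_weight; rewrite fold_right_app; simpl; rewrite Rmult_1_r.
  induction a as [| y a IH]; simpl; [ring | rewrite IH; ring].
Qed.

Lemma cylinder_weight d r q a :
  fold_right (fun p acc => r (snd p) * acc) 1 (cylinder d q a) = word_weight r a.
Proof.
  revert q; induction a as [| x a IH]; intros q; [reflexivity |].
  simpl; rewrite IH; reflexivity.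
Qed.

(** * Law of large numbers for the labels read *)

Section RandomConfiguration.

Context {d : nat} {r : nat -> R} {Om : Type} {F : (Om -> Prop) -> Prop}
  {P : (Om -> Prop) -> R} {rho : Om -> config}.
Hypothesis d_ge2 : (2 <= d)%nat.
Hypothesis r_prob : prob_vector d r.
Hypothesis prob : is_probability_space F P.
Hypothesis rho_le : forall w v, (rho w v <= d)%nat.
Hypothesis rho_event : forall v j, F (fun w => rho w v = j).
Hypothesis rho_iid : iid_config d r P rho.

Lemma cylinder_event (l : list (vertex * nat)) :
  F (fun w => Forall (fun p => rho w (fst p) = snd p) l).
Proof.
  induction l as [| p l IH].
  - apply event_ext_in with (fun _ => True); [| apply (event_full prob)].
    intros w; split; [trivial | constructor].
  - apply event_ext_in with
      (fun w => rho w (fst p) = snd p /\ Forall (fun p => rho w (fst p) = snd p) l).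
    + intros w; apply Forall_cons_iff.
    + apply (event_and prob); [apply rho_event | exact IH].
Qed.

(** The vertices read are random, but prescribing the labels makes them the fixed, distinct vertices
    of a cylinder, to which [iid_config] applies. *)
Lemma labels_law a :
  Forall (fun x => (x <= d)%nat) a ->
  F (fun w => map (label d (rho w)) (seq 0 (length a)) = a) /\
  P (fun w => map (label d (rho w)) (seq 0 (length a)) = a) = word_weight r a.
Proof.
  intros Ha.
  rewrite (event_ext (fun w => map (label d (rho w)) (seq 0 (length a)) = a)
             (fun w => Forall (fun p => rho w (fst p) = snd p) (cylinder d [[]] a)))
    by (intros w; symmetry; apply cylinder_labels).
  split; [apply cylinder_event |].
  rewrite rho_iid; [apply cylinder_weight | |].
  - apply cylinder_nodup; [exact d_ge2 | exact Ha | discriminate | apply antichain_root].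
  - apply cylinder_valid; [exact d_ge2 | exact Ha | discriminate | repeat constructor].
Qed.

(** Given the prefix [a], the next [n] labels have the product law. The induction splits on the next
    label and appends it to [a]; as there are finitely many words, any [g] yields an event. *)
Lemma labels_event_law (g : list nat -> Prop) n a :
  Forall (fun x => (x <= d)%nat) a ->
  F (fun w => map (label d (rho w)) (seq 0 (length a)) = a /\
              g (map (label d (rho w)) (seq (length a) n))) /\
  P (fun w => map (label d (rho w)) (seq 0 (length a)) = a /\
              g (map (label d (rho w)) (seq (length a) n)))
  = word_weight r a *
    word_mean (d := d) (r := r) n (fun b => if excluded_middle_informative (g b) then 1 else 0).
Proof.
  revert g a; induction n as [| n IH]; intros g a Ha.
  - destruct (labels_law a Ha) as [HF HP]; cbn [seq map word_mean].
    destruct (excluded_middle_informative (g [])) as [Hg | Hg].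
    + rewrite (event_ext (fun w => map (label d (rho w)) (seq 0 (length a)) = a /\ g [])
                 (fun w => map (label d (rho w)) (seq 0 (length a)) = a)) by tauto.
      split; [exact HF | rewrite HP; ring].
    + rewrite (event_ext (fun w => map (label d (rho w)) (seq 0 (length a)) = a /\ g [])
                 (fun _ => False)) by tauto.
      split; [apply (event_empty prob) | rewrite (prob_empty prob); ring].
  - set (A := fun x w => map (label d (rho w)) (seq 0 (length (a ++ [x]))) = a ++ [x] /\
                         g (x :: map (label d (rho w)) (seq (length (a ++ [x])) n))).
    assert (HA : forall x, (x <= d)%nat -> F (A x) /\ P (A x) = word_weight r (a ++ [x]) *
      word_mean (d := d) (r := r) n (fun b => if excluded_middle_informative (g (x :: b)) then 1 else 0)).
    { intros x Hx; apply (IH (fun b => g (x :: b))).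
      apply Forall_app; split; [exact Ha | repeat constructor; exact Hx]. }
    assert (Hl : forall x, length (a ++ [x]) = S (length a))
      by (intros x; rewrite length_app; simpl; lia).
    assert (HAx : forall x w, A x w <->
      map (label d (rho w)) (seq 0 (length a)) = a /\ label d (rho w) (length a) = x /\
      g (map (label d (rho w)) (seq (length a) (S n)))).
    { intros x w; unfold A; rewrite Hl, seq_S, map_app; cbn [seq map Nat.add]; split.
      - intros [E Hg]; apply app_inj_tail in E; destruct E as [E <-]; tauto.
      - intros [-> [<- Hg]]; tauto. }
    assert (HF : forall x, F (A x)).
    { intros x; destruct (le_lt_dec x d) as [Hx | Hx]; [apply HA; exact Hx |].
      (* The family [A] is indexed by all naturals; beyond [d] its events are empty. *)
      apply event_ext_in with (fun _ => False); [| apply (event_empty prob)].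
      intros w; split; [| tauto]; intros H; apply HAx in H; destruct H as [_ [E _]].
      assert (H := rho_le w (explored d (rho w) (length a))); unfold label in E; lia. }
    rewrite (event_ext (fun w => map (label d (rho w)) (seq 0 (length a)) = a /\
                                 g (map (label d (rho w)) (seq (length a) (S n))))
               (fun w => exists x, (x <= d)%nat /\ A x w)).
    + split.
      * apply event_ext_in with (fun w => exists x, (x < S d)%nat /\ A x w).
        -- intros w; split; intros [x [Hx H]]; exists x; (split; [lia | exact H]).
        -- apply (event_bounded_union prob); exact HF.
      * rewrite (prob_finite_additive prob); [| exact HF |].
        -- cbn [word_mean]; rewrite scal_sum; apply sum_eq; intros x Hx.
           rewrite (proj2 (HA x Hx)), word_weight_snoc; ring.
        -- intros x y w Hne Hx Hy; apply HAx in Hx, Hy.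
           apply Hne; rewrite <- (proj1 (proj2 Hx)); apply Hy.
    + intros w; split.
      * intros [E Hg]; exists (label d (rho w) (length a)); split; [apply rho_le |].
        apply HAx; tauto.
      * intros [x [_ H]]; apply HAx in H; tauto.
Qed.

Lemma negative_drift_almost_sure f :
  sum_f_R0 (fun x => r x * f x) d < 0 ->
  F (fun w => exists N, forall n, (N <= n)%nat ->
       ~ 0 <= list_Rsum f (map (label d (rho w)) (seq 0 n))) /\
  P (fun w => exists N, forall n, (N <= n)%nat ->
       ~ 0 <= list_Rsum f (map (label d (rho w)) (seq 0 n))) = 1.
Proof.
  intros Hf; destruct (exponential_moment_lt_1 r_prob f Hf) as [s [Hs Hq]].
  assert (Hlaw : forall n,
    F (fun w => 0 <= list_Rsum f (map (label d (rho w)) (seq 0 n))) /\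
    P (fun w => 0 <= list_Rsum f (map (label d (rho w)) (seq 0 n)))
    = word_mean (d := d) (r := r) n (fun b => if excluded_middle_informative (0 <= list_Rsum f b) then 1 else 0)).
  { intros n; assert (H := labels_event_law (fun b => 0 <= list_Rsum f b) n []
                             (Forall_nil _)).
    cbn [length seq map word_weight fold_right] in H; rewrite Rmult_1_l in H.
    (* The trivial condition is what the empty prefix leaves in the law above. *)
    rewrite (event_ext (fun w => 0 <= list_Rsum f (map (label d (rho w)) (seq 0 n)))
      (fun w => @nil nat = [] /\ 0 <= list_Rsum f (map (label d (rho w)) (seq 0 n))))
      by (intros w; tauto).
    exact H. }
  apply (borel_cantelli_geometric prob
           (fun n w => 0 <= list_Rsum f (map (label d (rho w)) (seq 0 n)))
           (sum_f_R0 (fun x => r x * exp (s * f x)) d)).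
  - exact Hq.
  - intros n; apply Hlaw.
  - intros n; rewrite (proj2 (Hlaw n)); apply chernoff; [exact r_prob | exact Hs].
Qed.

Lemma label_strong_law :
  exists A : Om -> Prop, F A /\ P A = 1 /\ forall w, A w ->
    forall e, 0 < e -> exists N, forall n, (N <= n)%nat ->
      Rabs (INR (label_sum d (rho w) n) - mean d r * INR n) <= e * INR n.
Proof.
  (* For [b = 0] this is [x - mean - 1 / (j + 1)], otherwise [mean - x - 1 / (j + 1)]; both have
     mean [- 1 / (j + 1)] and give the two one-sided bounds. The index [b] is a natural number so
     that countable intersections apply to it. *)
  set (f := fun (j b : nat) (x : nat) =>
    (if Nat.eqb b 0 then 1 else -1) * INR x
    + ((if Nat.eqb b 0 then - mean d r else mean d r) - / INR (S j))).
  assert (Hf : forall j b, sum_f_R0 (fun x => r x * f j b x) d < 0).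
  { intros j b; destruct r_prob as [_ Hr1].
    assert (Hj : 0 < / INR (S j)) by (apply Rinv_0_lt_compat, lt_0_INR; lia).
    set (p := if Nat.eqb b 0 then 1 else -1).
    set (q := (if Nat.eqb b 0 then - mean d r else mean d r) - / INR (S j)).
    rewrite (sum_eq _ (fun x => INR x * r x * p + r x * q))
      by (intros x _; unfold f; fold p q; ring).
    rewrite sum_plus, <- !scal_sum, Hr1; fold (mean d r).
    unfold p, q; destruct (Nat.eqb b 0); lra. }
  set (A := fun j b w => exists N, forall n, (N <= n)%nat ->
       ~ 0 <= list_Rsum (f j b) (map (label d (rho w)) (seq 0 n))).
  assert (HA : forall j b, F (A j b) /\ P (A j b) = 1)
    by (intros j b; apply negative_drift_almost_sure, Hf).
  exists (fun w => forall j b, A j b w); split; [| split].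
  - apply (event_inter prob (fun j w => forall b, A j b w)); intros j.
    apply (event_inter prob); intros b; apply HA.
  - apply (almost_sure_inter prob (fun j w => forall b, A j b w)); intros j.
    + apply (event_inter prob); intros b; apply HA.
    + apply (almost_sure_inter prob); intros b; apply HA.
  - intros w Hw e He.
    destruct (archimed_cor1 e He) as [[| j] [Hj Hj0]]; [lia |].
    destruct (Hw j 0%nat) as [N0 H0], (Hw j 1%nat) as [N1 H1].
    exists (max N0 N1); intros n Hn.
    specialize (H0 n ltac:(lia)); specialize (H1 n ltac:(lia)).
    unfold f in H0, H1; rewrite list_Rsum_affine, length_map, length_seq in H0, H1.
    cbn [Nat.eqb] in H0, H1; fold (label_sum d (rho w) n) in H0, H1.
    assert (Hn0 := pos_INR n).
    apply Rabs_le; nra.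
Qed.

End RandomConfiguration.

(** * The limit *)

(** Weakens the exponential growth of the range to a quadratic one, which suffices to make [k]
    negligible. *)
Lemma square_le_pow2 k : (k * k + 1 <= 2 * 2 ^ k)%nat.
Proof.
  induction k as [| k IH]; [simpl; lia |].
  assert (H : (k + 1 <= 2 ^ k)%nat) by (assert (H := Nat.pow_gt_lin_r 2 k ltac:(lia)); lia).
  rewrite Nat.pow_succ_r'; lia.
Qed.

Section Limit.

Context {d : nat} {c : config} {mu : R}.
Hypothesis d_ge2 : (2 <= d)%nat.
Hypothesis c_le : forall v, (c v <= d)%nat.
Hypothesis mu_gt : mu > INR d - 1.
Hypothesis strong_law : forall e, 0 < e -> exists N, forall n, (N <= n)%nat ->
  Rabs (INR (label_sum d c n) - mu * INR n) <= e * INR n.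

Lemma positive_drift C :
  exists N, forall n, (N <= n)%nat -> (C + d * n <= label_sum d c n + n)%nat.
Proof.
  (* Half of the gap: eventually the label sum exceeds [(d - 1) * n] by at least [e * n], which
     passes any [C]. *)
  set (e := (mu - (INR d - 1)) / 2).
  assert (He : 0 < e) by (unfold e; lra).
  destruct (strong_law e He) as [N HN].
  destruct (INR_unbounded (INR C / e)) as [N' HN'].
  exists (max N N'); intros n Hn.
  apply INR_le; rewrite !plus_INR, mult_INR.
  assert (H := Rabs_le_bounds _ _ (HN n ltac:(lia))).
  assert (Hn' : INR N' <= INR n) by (apply le_INR; lia).
  assert (HC : INR C <= e * INR n).
  { apply Rle_trans with (e * (INR C / e)); [apply Req_le; field; lra |].
    apply Rmult_le_compat_l; lra. }
  unfold e in *; nra.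
Qed.

(** Existence is proved by induction and the values are then chosen for each [k] separately; the
    invariant links them to [k] alone. *)
Lemma excursion_starts_exist :
  exists m b : nat -> nat, forall k, excursion_start (d := d) (c := c) k (m k) (b k).
Proof.
  assert (H : forall k, exists p : nat * nat,
             excursion_start (d := d) (c := c) k (fst p) (snd p)).
  { induction k as [| k [[m b] IH]].
    - exists (0, 0)%nat; apply excursion_start_0; assumption.
    - destruct (excursion_start_next d_ge2 c_le k m b positive_drift IH) as [m' [b' H]].
      exists (m', b'); exact H. }
  exists (fun k => fst (proj1_sig (constructive_indefinite_description _ (H k)))),
         (fun k => snd (proj1_sig (constructive_indefinite_description _ (H k)))).
  intros k; exact (proj2_sig (constructive_indefinite_description _ (H k))).
Qed.

Lemma range_over_return_time_limit (m b : nat -> nat) :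
  (forall k, excursion_start (d := d) (c := c) k (m k) (b k)) ->
  Un_cv (fun k => INR (range_card d c (b k - 1)) / INR (b k - 1)) ((INR d - 1) / (2 * mu)).
Proof.
  intros Hstart e He.
  assert (Hd : 2 <= INR d) by (apply (le_INR 2), d_ge2).
  set (eta := Rmin e 1).
  assert (Heta : 0 < eta) by (apply Rmin_glb_lt; lra).
  assert (Heta1 : eta <= 1) by apply Rmin_r.
  assert (Hetae : eta <= e) by apply Rmin_l.
  destruct (strong_law (eta / 4) ltac:(lra)) as [N HN].
  (* Below, [2 * K + D <= 3 * K] and [M >= K * K / 4], so [eta * K >= 24] gives
     [3 * K <= eta / 2 * M]. *)
  destruct (INR_unbounded (24 / eta)) as [N' HN'].
  exists (N + d + N' + 2)%nat; intros k Hk.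
  destruct (Hstart k) as [_ [_ [_ [_ [Hsink [Hb Hpow]]]]]].
  rewrite (excursion_start_range d_ge2 c_le k (m k)) by (lia || apply Hstart).
  assert (Hb1 : (1 <= b k)%nat) by (apply Hsink; lia); clear Hsink.
  assert (Hkk := square_le_pow2 k).
  assert (Hm : (k * k <= 2 * m k + 1)%nat) by lia.
  assert (HmN : (N <= m k)%nat) by nia.
  assert (Hlaw := Rabs_le_bounds _ _ (HN (m k) HmN)).
  replace (b k) with (S (b k - 1)) in Hb by lia.
  set (t := (b k - 1)%nat) in *; clearbody t.
  apply (f_equal INR) in Hb.
  rewrite !plus_INR, !mult_INR, S_INR in Hb; change (INR 2) with 2 in Hb.
  apply le_INR in Hm; rewrite plus_INR, !mult_INR in Hm; simpl in Hm.
  assert (HkN' : INR N' <= INR k) by (apply le_INR; lia).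
  assert (Hkd : INR d <= INR k) by (apply le_INR; lia).
  assert (Heta24 : 24 <= eta * INR k).
  { apply Rle_trans with (eta * (24 / eta)); [apply Req_le; field; lra |].
    apply Rmult_le_compat_l; lra. }
  set (M := INR (m k)) in *; set (T := INR t) in *; set (K := INR k) in *.
  set (Sm := INR (label_sum d c (m k))) in *; set (D := INR d) in *.
  assert (HM : K * K <= 4 * M) by nra.
  assert (Hsmall : 2 * K + D <= eta / 2 * M) by nra.
  (* By [Hb] the difference is [2 * (mu * M - Sm) + 2 * K + D - 1]: half of the error comes from the
     strong law, half from [Hsmall]. *)
  assert (Hclose : Rabs (2 * mu * M - (D - 1) * T) <= eta * M)
    by (apply Rabs_le; nra).
  assert (HM0 : 0 < M) by nra.
  (* As [mu > D - 1 >= 1 >= eta], one has [(D - 1) * T >= (2 * mu - eta) * M >= (D - 1) * M]. *)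
  assert (HT : M <= T).
  { apply Rabs_le_bounds in Hclose.
    apply Rmult_le_reg_l with (D - 1); [lra |]; nra. }
  unfold Rdist.
  replace (M / T - (D - 1) / (2 * mu)) with ((2 * mu * M - (D - 1) * T) * / (2 * mu * T))
    by (field; lra).
  rewrite Rabs_mult, (Rabs_pos_eq (/ _)) by (left; apply Rinv_0_lt_compat; nra).
  apply Rmult_lt_reg_r with (2 * mu * T); [nra |].
  rewrite Rmult_assoc, Rinv_l, Rmult_1_r by nra.
  apply Rle_lt_trans with (1 := Hclose).
  apply Rle_lt_trans with (e * T); [apply Rmult_le_compat; lra |].
  apply Rmult_lt_compat_l; nra.
Qed.

End Limit.

Theorem theorem3p2 (d : nat) (r : nat -> R) (Om : Type)
  (F : (Om -> Prop) -> Prop) (P : (Om -> Prop) -> R) (rho : Om -> config) :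
  (2 <= d)%nat ->
  prob_vector d r ->
  is_probability_space F P ->
  (forall w v, (rho w v <= d)%nat) ->
  (forall v j, F (fun w => rho w v = j)) ->
  iid_config d r P rho ->
  mean d r > INR d - 1 ->
  exists A : Om -> Prop,
    F A /\ P A = 1 /\
    forall w, A w ->
      exists tau : nat -> nat,
        (forall k, is_return_time d (rho w) k (tau k)) /\
        Un_cv (fun k => INR (range_card d (rho w) (tau k)) / INR (tau k))
              ((INR d - 1) / (2 * mean d r)).
Proof.
  intros Hd Hr Hprob Hle HF Hiid Hmean.
  destruct (label_strong_law Hd Hr Hprob Hle HF Hiid) as [A [HA [HPA Hlaw]]].
  exists A; split; [exact HA | split; [exact HPA |]].
  intros w Hw.
  destruct (excursion_starts_exist Hd (Hle w) Hmean (Hlaw w Hw)) as [m [b Hstart]].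
  exists (fun k => (b k - 1)%nat); split.
  - intros k; apply excursion_start_return with (m k); auto.
  - exact (range_over_return_time_limit Hd (Hle w) Hmean (Hlaw w Hw) m b Hstart).
Qed.
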